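(* Let $\ell\ge r\ge3$. Then $\mathrm{proj}\,\Omega(H_{\ell+1}^r)=[0,1]$ and \[ g(H_{\ell+1}^r,x)=(\ell-r+1)\left(\frac{x^r}{(\ell)_r}\right)^{\frac1{r-1}} \] for all $x\in[0,(\ell)_{r-1}/\ell^{r-1}]$.
   Context: $(\ell)_r=\ell(\ell-1)\cdots(\ell-r+1)$. $H_{\ell+1}^r$ (the expansion of a clique) is the $r$-graph obtained from the complete graph $K_{\ell+1}$ by adding $r-2$ new vertices to each edge, the new vertices being distinct for distinct edges. An $r$-graph $\mathcal{H}$ is a finite vertex set $V(\mathcal{H})$ together with a set of $r$-element subsets (edges); $v(\mathcal{H})=|V(\mathcal{H})|$. The shadow is $\partial\mathcal{H}=\{A\in\binom{V(\mathcal{H})}{r-1}: A\subset B\text{ for some }B\in\mathcal{H}\}$. $\mathcal{H}$ is $H_{\ell+1}^r$-free if it contains no copy of $H_{\ell+1}^r$ as a (not necessarily induced) subgraph. Densities: $d(\mathcal{H})=|\mathcal{H}|/\binom{v(\mathcal{H})}{r}$, $d(\partial\mathcal{H})=|\partial\mathcal{H}|/\binom{v(\mathcal{H})}{r-1}$. A sequence $(\mathcal{H}_k)$ is good if $v(\mathcal{H}_k)\to\infty$ and both density limits exist; it realizes $(x,y)$ if $\lim d(\partial\mathcal{H}_k)=x$ and $\lim d(\mathcal{H}_k)=y$. $\Omega(H_{\ell+1}^r)$ is the set of points of $[0,1]^2$ realized by good sequences of $H_{\ell+1}^r$-free $r$-graphs (a closed set); $\mathrm{proj}\,\Omega$ is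 its projection to the first coordinate and $g(H_{\ell+1}^r,x)=\max\{y:(x,y)\in\Omega(H_{\ell+1}^r)\}$.
   Formalization: The printed denominator $(\ell)_r$ is replaced by $(\ell)_{r-1}$; with $(\ell)_r$ the formula fails for $\ell>r$, e.g. $\ell=4$, $r=3$, $x=3/4$, where complete balanced 4-partite 3-graphs realize $y=3/8$ but the formula gives about 0.265. *)

(* Defs.v *)
From mathcomp Require Export all_boot all_order all_algebra.
From mathcomp Require Export all_classical all_reals all_analysis.

Set Implicit Arguments.
Unset Strict Implicit.
Unset Printing Implicit Defensive.

Import Order.TTheory GRing.Theory Num.Theory.
Import numFieldNormedType.Exports.

Local Open Scope classical_set_scope.
Local Open Scope ring_scope.

Record hypergraph := Hypergraph {
  vertex : finType;
  edges : {set {set vertex}}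
}.

Definition uniform (r : nat) (H : hypergraph) : Prop :=
  forall e : {set vertex H}, e \in edges H -> #|e| = r.

Definition nvert (H : hypergraph) : nat := #|vertex H|.

Definition contains_copy (F H : hypergraph) : Prop :=
  exists f : vertex F -> vertex H,
    injective f /\
    forall e : {set vertex F}, e \in edges F -> f @: e \in edges H.

Definition is_free (F H : hypergraph) : Prop := ~ contains_copy F H.

Definition shadow (r : nat) (H : hypergraph) : {set {set vertex H}} :=
  [set A : {set vertex H} | (#|A| == r.-1) && [exists B in edges H, A \subset B]].

(* The degenerate case of a zero binomial coefficient (fewer than r vertices)
   gives density 0; it is irrelevant along sequences with v(H_k) -> oo. *)
Definition density (R : realType) (r : nat) (H : hypergraph) : R :=
  #|edges H|%:R / 'C(nvert H, r)%:R.

Definition shadow_density (R : realType) (r : nat) (H : hypergraph) : R :=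
  #|shadow r H|%:R / 'C(nvert H, r.-1)%:R.

Definition good_seq (R : realType) (r : nat) (H : nat -> hypergraph) : Prop :=
  [/\ (fun k => nvert (H k)) @ \oo --> \oo,
      cvgn (fun k => shadow_density R r (H k)) &
      cvgn (fun k => density R r (H k))].

Definition realizes (R : realType) (r : nat) (H : nat -> hypergraph)
    (p : R * R) : Prop :=
  [/\ good_seq R r H,
      (fun k => shadow_density R r (H k)) @ \oo --> p.1 &
      (fun k => density R r (H k)) @ \oo --> p.2].

(* The region written Omega(F). *)
Definition feasible_region (R : realType) (r : nat) (F : hypergraph) :
    set (R * R) :=
  [set p : R * R |
    [/\ p.1 \in `[0, 1], p.2 \in `[0, 1] &
        exists H : nat -> hypergraph,
          [/\ forall k, uniform r (H k),
              forall k, is_free F (H k) &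
              realizes r H p]]].
Arguments feasible_region R r F : clear implicits.

(* proj Omega(F) *)
Definition proj_feasible (R : realType) (r : nat) (F : hypergraph) : set R :=
  fst @` feasible_region R r F.
Arguments proj_feasible R r F : clear implicits.

Definition is_maximum (R : realType) (A : set R) (m : R) : Prop :=
  A m /\ ubound A m.

(* The graph of the (partial) function g: [feasible_max r F x y] means that
   the maximum g(F, x) exists and equals y. *)
Definition feasible_max (R : realType) (r : nat) (F : hypergraph)
    (x y : R) : Prop :=
  is_maximum [set z : R | feasible_region R r F (x, z)] y.

(* The edges of the complete graph K_m. *)
Definition Kedge (m : nat) : finType := {e : {set 'I_m} | #|e| == 2}.

(* The expansion of K_m: [inl i] is an original vertex of K_m, and
   [inr (e, j)] is the j-th of the r - 2 vertices added to the edge e. *)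
Definition expansion_vertex (m r : nat) : finType :=
  ('I_m + Kedge m * 'I_(r - 2))%type.

Definition expansion_edge (m r : nat) (e : Kedge m) :
    {set expansion_vertex m r} :=
  [set (inl i : expansion_vertex m r) | i in val e]
    :|: [set (inr (e, j) : expansion_vertex m r) | j : 'I_(r - 2)].

(* H_m^r; the notation H_{l+1}^r is [clique_expansion l.+1 r]. *)
Definition clique_expansion (m r : nat) : hypergraph :=
  @Hypergraph (expansion_vertex m r)
    [set expansion_edge r e | e : Kedge m].

Lemma clique_expansion_uniform (m r : nat) :
  (2 <= r)%N -> uniform r (clique_expansion m r).
Proof.
move=> r2 A /imsetP[e _ ->]; rewrite /expansion_edge cardsU.
rewrite card_imset; last by move=> i j [].
rewrite card_imset; last by move=> i j [].
rewrite (eqP (valP e)) card_ord.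
rewrite [X in (_ - X)%N]eq_card0 ?subn0 ?subnKC // => x; rewrite !inE.
by apply/negP => /andP[/imsetP[i _ ->]] /imsetP[].
Qed.

(* Main.v *)
(* Upper bound.  Call a pair of vertices light if the edges containing it are
   all met by some bounded set avoiding the pair.  Only O(n^(r-1)) edges contain
   a light pair, and a clique K_(l+1) of heavy pairs expands greedily to
   H_(l+1)^r; so, after deleting o(n^r) edges, every edge is a clique of a
   K_(l+1)-free graph.  For such an r-graph let (X_1, ..., X_r) be a uniformly
   random ordered edge and h_i = H(X_i | X_1, ..., X_(i-1)).  Conditionally on
   X_1, ..., X_(i-1), the pair (X_i, X_(i+1)) is supported on a
   K_(l-i+2)-free graph, so Motzkin-Straus and Jensen give
   h_(i+1) - h_i <= ln ((l-i) / (l-i+1)).  Since h_1 + ... + h_r is the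
   logarithm of the number of ordered edges and h_1 + ... + h_(r-1) is at most
   that of the ordered shadow, summing these inequalities gives
   (r! |E|)^(r-1) (l)_(r-1) <= (l-r+1)^(r-1) ((r-1)! |dE|)^r.

   Lower bound: balanced complete l-partite r-graphs plus isolated vertices.

   Projection: the edges of H_(l+1)^r have no common vertex, so any r-graph
   whose edges all contain a fixed vertex is H_(l+1)^r-free; its link can be
   any (r-1)-graph, and its edge density tends to 0. *)
From mathcomp Require Import ring lra zify.
Require Import Defs.
From mathcomp Require Import fintype finset perm.

Set Implicit Arguments.
Unset Strict Implicit.
Unset Printing Implicit Defensive.

Import Order.TTheory GRing.Theory Num.Theory.
Import numFieldNormedType.Exports.
Local Open Scope ring_scope.

(** * Counting edges through the shadow *)

(** Induction on the clique bound through a vertex [v] of largest weighted degree in [U]. A clique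
    in its neighbourhood [N] extends by [v], so [N] satisfies the hypothesis for the smaller [m],
    while vertices of [U] outside [N] have weighted degree at most that of [v]. *)
Lemma motzkin_straus (R : realFieldType) (T : finType) (E : rel T) (w : T -> R)
    (m : nat) (U : {set T}) :
  symmetric E -> irreflexive E -> (forall v, 0 <= w v) ->
  (forall C : {set T}, C \subset U ->
     {in C &, forall u v, u != v -> E u v} -> (#|C| <= m.+1)%N) ->
  m.+1%:R * (\sum_(u in U) \sum_(v in U | E u v) w u * w v)
    <= m%:R * (\sum_(u in U) w u) ^+ 2.
Proof.
move=> Esym Eirr w0; elim: m U => [|m IHm] U hC.
  rewrite mul0r mul1r big1 // => u uU; rewrite big1 // => v /andP[vU Euv].
  have uv : u != v by apply: contraTneq Euv => ->; rewrite Eirr.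
  have : (#|[set u; v]| <= 1)%N; last by rewrite cards2 uv.
  apply: hC => [|x y].
    by apply/subsetP => x; rewrite !inE => /orP[] /eqP->.
  by rewrite !inE => /orP[]/eqP-> /orP[]/eqP->; rewrite ?eqxx // Esym.
have [U0|[v0 v0U]] := set_0Vmem U; first by rewrite U0 !big_set0 expr0n !mulr0.
pose d u := \sum_(v in U | E u v) w v.
have QE : \sum_(u in U) \sum_(v in U | E u v) w u * w v = \sum_(u in U) w u * d u.
  by apply: eq_bigr => u _; rewrite mulr_sumr.
have [v vU vmax] : exists2 v, v \in U & forall u, u \in U -> d u <= d v.
  by case: (@arg_maxP _ _ T v0 (mem U) d v0U) => v; exists v.
pose N := [set z in U | E v z].
have NU : N \subset U by apply/subsetP => z; rewrite inE => /andP[].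
have dvE : d v = \sum_(z in N) w z by apply: eq_bigl => z; rewrite !inE.
have /IHm : forall C : {set T}, C \subset N ->
    {in C &, forall u v, u != v -> E u v} -> (#|C| <= m.+1)%N.
  move=> C CN hE.
  have vC : v \notin C.
    by apply/negP => /(subsetP CN); rewrite !inE Eirr andbF.
  have := hC (v |: C); rewrite cardsU1 vC; apply.
    by rewrite subUset sub1set vU (subset_trans CN).
  move=> x y; rewrite !inE => /predU1P[->|xC] /predU1P[->|yC]; rewrite ?eqxx //.
  - by move=> _; move/(subsetP CN): yC; rewrite inE => /andP[].
  - by move=> _; move/(subsetP CN): xC; rewrite inE Esym => /andP[].
  - exact: hE.
rewrite -dvE; set QN := \sum_(u in N) _ => hN.
set M := \sum_(u in U) w u.
pose X := \sum_(u in U | u \notin N) w u * d u.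
have hX : X <= (M - d v) * d v.
  have -> : M - d v = \sum_(u in U | u \notin N) w u.
    rewrite /M (bigID (mem N)) /= dvE addrC.
    rewrite [X in _ + X - _](_ : _ = \sum_(z in N) w z) ?addrK //.
    by apply: eq_bigl => u; rewrite andb_idl // => /(subsetP NU).
  rewrite mulr_suml ler_sum // => u /andP[uU _].
  by rewrite ler_wpM2l //; apply: vmax.
(* The form is at most [2 (M - D) D + QN] with [D = d v] and [M] the total
   weight; combined with the induction bound on [QN] this leaves the square of
   [(m + 1) M - (m + 2) D]. *)
have hQ : \sum_(u in U) w u * d u <= X + (QN + X).
  rewrite (bigID (mem N)) /= addrC lerD2l.
  rewrite (eq_bigl (mem N)); last first.
    by move=> u; rewrite andb_idl // => /(subsetP NU).
  have -> : \sum_(u in N) w u * d u =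
      QN + \sum_(u in N) \sum_(z in U | E u z && (z \notin N)) w u * w z.
    rewrite -big_split; apply: eq_bigr => u uN /=.
    rewrite mulr_sumr (bigID (mem N)) /=; congr (_ + _); apply: eq_bigl => z.
      case: (boolP (z \in N)) => [zN|]; last by rewrite andbF.
      by rewrite (subsetP NU _ zN) andbT.
    by rewrite andbA.
  rewrite lerD2l (exchange_big_dep (fun z => (z \in U) && (z \notin N))) /=.
    apply: ler_sum => z /andP[zU zN]; rewrite mulr_sumr.
    rewrite [leRHS](bigID (mem N)) /= -[leLHS]addr0 lerD //.
      rewrite le_eqVlt; apply/orP; left; apply/eqP; apply: eq_big.
        move=> u; rewrite zU zN andbT /= Esym; case: (boolP (u \in N)) => //= uN.
          by rewrite (subsetP NU _ uN) andbT.
        by rewrite andbF.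
      by move=> u _; rewrite mulrC.
    by apply: sumr_ge0 => u _; rewrite mulr_ge0.
  by move=> u z _ /and3P[-> _ ->].
rewrite QE; set Q := \sum_(u in U) w u * d u in hQ *.
have m1 : 0 < m.+1%:R :> R by rewrite ltr0n.
rewrite -(ler_pM2l m1) -(@natr1 _ m.+1) -(@natr1 _ m).
rewrite -(natr1 m) in hN m1.
have m0 : 0 <= m%:R :> R by [].
move: hX hQ hN m1 m0; move: (m%:R : R) (d v) => a D.
move=> hX hQ hN m1 m0.
have : 0 <= ((a + 1) * M - (a + 1 + 1) * D) ^+ 2 by apply: sqr_ge0.
have hQ' : Q <= 2 * ((M - D) * D) + QN by lra.
have a2 : 0 <= (a + 1) * (a + 1 + 1) by apply: mulr_ge0; lra.
have := ler_wpM2l a2 hQ'.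
have : 0 <= a + 1 + 1 by lra.
move/ler_wpM2l => /(_ _ _ hN).
lra.
Qed.

(** For t uniform in [S], [#|fiber S f t|] over [#|S|] is the probability of the value [f t]. Hence
    the sum of the logarithms of the fibre sizes over [S] is |S| (ln |S| - H(f)). *)
Definition fiber (T A : finType) (S : {set T}) (f : T -> A) (t : T) : {set T} :=
  [set t' in S | f t' == f t].

Lemma fiber_gt0 (T A : finType) (S : {set T}) (f : T -> A) (t : T) :
  t \in S -> (0 < #|fiber S f t|)%N.
Proof. by move=> tS; apply/card_gt0P; exists t; rewrite inE tS eqxx. Qed.

Lemma eq_fiber (T A B : finType) (S : {set T}) (f : T -> A) (g : T -> B)
    (t : T) :
  (forall t', (f t' == f t) = (g t' == g t)) -> fiber S f t = fiber S g t.
Proof. by move=> fg; apply/setP => t'; rewrite !inE fg. Qed.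

Lemma ln_le_sub1 (R : realType) (x : R) : 0 < x -> ln x <= x - 1.
Proof.
move=> x0; rewrite -[X in ln X](subrK 1) addrC; apply: le_ln1Dx.
by rewrite ltrBDr addNr.
Qed.

Lemma sum_fiber_inv (R : numFieldType) (T A : finType) (S : {set T})
    (f : T -> A) :
  \sum_(t in S) (#|fiber S f t|%:R : R)^-1 = #|f @: S|%:R.
Proof.
rewrite (partition_big_imset f) -sumr_const; apply: eq_bigr => a /imsetP[t tS ->].
rewrite (eq_bigr (fun=> (#|fiber S f t|%:R : R)^-1)) => [|i /andP[_ /eqP fi]].
  rewrite (eq_bigl (mem (fiber S f t))) => [|i]; last by rewrite !inE.
  by rewrite sumr_const -[LHS]mulr_natl divff // pnatr_eq0 -lt0n fiber_gt0.
by rewrite /fiber fi.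
Qed.

(** The left side is |S| H(f), and entropy is largest for a uniform distribution: [ln_le_sub1] is
    applied to the ratios [q t], whose sum is |S| by [sum_fiber_inv]. *)
Lemma entropy_le_ln_card (R : realType) (T A : finType) (S : {set T})
    (f : T -> A) :
  #|S|%:R * ln (#|S|%:R : R) - \sum_(t in S) ln (#|fiber S f t|%:R : R)
    <= #|S|%:R * ln (#|f @: S|%:R : R).
Proof.
have [->|[t0 t0S]] := set_0Vmem S.
  by rewrite cards0 big_set0 !mul0r subr0.
have S0 : (0 : R) < #|S|%:R by rewrite ltr0n; apply/card_gt0P; exists t0.
have s0 : (0 : R) < #|f @: S|%:R.
  by rewrite ltr0n; apply/card_gt0P; exists (f t0); apply: imset_f.
have sumS (x : R) : #|S|%:R * x = \sum_(t in S) x.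
  by rewrite sumr_const mulr_natl.
rewrite -subr_le0 !sumS -!sumrB.
pose q (t : T) : R := #|S|%:R / #|f @: S|%:R * (#|fiber S f t|%:R)^-1.
apply: (@le_trans _ _ (\sum_(t in S) (q t - 1))).
  apply: ler_sum => t tS; have c0 : (0 : R) < #|fiber S f t|%:R.
    by rewrite ltr0n fiber_gt0.
  rewrite -!ln_div ?posrE ?divr_gt0 // mulrAC; apply: ln_le_sub1.
  by rewrite !divr_gt0.
by rewrite sumrB -mulr_sumr sum_fiber_inv divfK ?gt_eqF // sumr_const subrr.
Qed.

(* For [t] uniform in [S] this bounds the conditional mutual information of
   [y t] and [z t] given [w t] from below: the tangent line of [ln] at
   [c = m.+1 / m.+2] reduces the sum of logarithms to a sum of ratios, which
   over each fibre of [w] is a Motzkin-Straus form. *)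
Lemma cond_entropy_step (R : realType) (T A V : finType) (S : {set T})
    (w : T -> A) (y z : T -> V) (s : T -> T) (m : nat) :
  {in S, forall t, [/\ s t \in S, s (s t) = t, w (s t) = w t & y (s t) = z t]} ->
  {in S, forall t, y t != z t} ->
  (forall (t0 : T) (C : {set V}), t0 \in S ->
     {in C &, forall u v, u != v ->
        exists t, [/\ t \in S, w t = w t0, y t = u & z t = v]} ->
     (#|C| <= m.+2)%N) ->
  \sum_(t in S) (ln (#|fiber S (fun t => (w t, y t)) t|%:R : R)
    + ln (#|fiber S (fun t => (w t, z t)) t|%:R : R)
    - ln (#|fiber S (fun t => (w t, y t, z t)) t|%:R : R)
    - ln (#|fiber S w t|%:R : R))
    <= #|S|%:R * ln (m.+1%:R / m.+2%:R : R).
Proof.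
move=> hs yz hC; set c : R := m.+1%:R / m.+2%:R.
have c0 : 0 < c by rewrite divr_gt0 ?ltr0n.
have zs t : t \in S -> z (s t) = y t.
  by move=> tS; have [sS ss _ _] := hs _ tS; have [_ _ _ <-] := hs _ sS; rewrite ss.
pose ratio (t : T) : R := #|fiber S (fun t => (w t, y t)) t|%:R
  * #|fiber S (fun t => (w t, z t)) t|%:R
  / #|fiber S (fun t => (w t, y t, z t)) t|%:R / #|fiber S w t|%:R.
apply: (@le_trans _ _ (\sum_(t in S) (ln c + (ratio t / c - 1)))).
  apply: ler_sum => t tS.
  have f0 (B : finType) (g : T -> B) : 0 < (#|fiber S g t|%:R : R).
    by rewrite ltr0n fiber_gt0.
  rewrite -lnM ?posrE ?f0 // -!ln_div ?posrE ?divr_gt0 ?mulr_gt0 ?f0 //.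
  rewrite -/(ratio t); have r0 : 0 < ratio t by rewrite !divr_gt0 ?mulr_gt0 ?f0.
  by rewrite -lerBlDl -ln_div //; apply: ln_le_sub1; rewrite divr_gt0.
rewrite big_split /= sumrB !sumr_const -mulr_suml -[ln c *+ _]mulr_natl.
rewrite gerDl subr_le0 ler_pdivrMr //.
rewrite (partition_big_imset w) [_%:R * c](_ : _ =
    \sum_(a in w @: S) \sum_(t in S | w t == a) c); last first.
  by rewrite -(partition_big_imset w) sumr_const mulr_natl.
apply: ler_sum => a /imsetP[t0 t0S ->].
pose Q := fiber S w t0; pose M : R := #|Q|%:R.
have M0 : 0 < M by rewrite ltr0n fiber_gt0.
pose n u : R := #|[set t in Q | y t == u]|%:R.
(* The involution [s] exchanges [y] and [z] inside the fibre [Q], so both have the same distribution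
   there. *)
have nz u : n u = #|[set t in Q | z t == u]|%:R.
  congr (_%:R); rewrite -(@card_in_imset _ _ s); last first.
    move=> t t'; rewrite !inE => /andP[/andP[tS _] _] /andP[/andP[t'S _] _] e.
    by have [_ <- _ _] := hs _ tS; have [_ <- _ _] := hs _ t'S; rewrite e.
  apply: eq_card => t; apply/imsetP/idP.
    move=> [t']; rewrite !inE => /andP[/andP[tS wt] yt] ->.
    by have [-> _ -> _] := hs _ tS; rewrite zs // wt yt.
  rewrite !inE => /andP[/andP[tS wt] zt]; have [sS ss ws ys] := hs _ tS.
  by exists (s t) => //; rewrite !inE sS ws wt ys zt.
pose E (u v : V) := [exists t in Q, (y t == u) && (z t == v)].
have ms := @motzkin_straus R V E n m.+1 [set: V].
have nM : \sum_(u in [set: V]) n u = M.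
  rewrite /M -sum1_card natr_sum (partition_big y xpredT) //=.
  apply: eq_big => [u|u _]; first by rewrite inE.
  by rewrite /n -sum1_card natr_sum; apply: eq_bigl => t; rewrite !inE.
have {ms} : m.+2%:R * (\sum_(u in [set: V]) \sum_(v in [set: V] | E u v) n u * n v)
    <= m.+1%:R * M ^+ 2.
  rewrite -nM; apply: ms => [u v|u|v|C _ CE].
  - apply/idP/idP => /existsP[t /and3P[]]; rewrite inE => /andP[tS wt];
      move=> /eqP yt /eqP zt; apply/existsP; exists (s t);
      have [sS ss ws ys] := hs _ tS; by rewrite !inE sS ws wt ys zs // yt zt !eqxx.
  - apply/negbTE/existsP => -[t /and3P[]]; rewrite inE => /andP[tS _].
    by move=> /eqP yt /eqP zt; have := yz _ tS; rewrite yt zt eqxx.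
  - by rewrite ler0n.
  - apply: (hC t0) => // u v uC vC uv.
    have /existsP[t /and3P[]] := CE _ _ uC vC uv; rewrite inE => /andP[tS /eqP wt].
    by move=> /eqP yt /eqP zt; exists t.
set F := \sum_(u in _) _ => hF.
(* A pair (u, v) related by [E] is attained by the [#|P|] elements t of [P], each with ratio n(u)
   n(v) / (|P| M), so it contributes n(u) n(v) / M. *)
have -> : \sum_(t in S | w t == w t0) ratio t = F / M.
  rewrite (partition_big (fun t => (y t, z t)) (fun p => E p.1 p.2)) /=; last first.
    by move=> t ?; apply/existsP; exists t; rewrite !inE !eqxx !andbT.
  rewrite mulr_suml; transitivity (\sum_(p | E p.1 p.2) n p.1 * n p.2 / M).
    apply: eq_bigr => -[u v] /= /existsP[t1 /and3P[]].
    rewrite inE => /andP[t1S /eqP wt1] /eqP yt1 /eqP zt1.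
    pose P := [set t in Q | (y t == u) && (z t == v)].
    have P0 : (#|P|%:R : R) != 0.
      rewrite pnatr_eq0 -lt0n; apply/card_gt0P; exists t1.
      by rewrite !inE t1S wt1 yt1 zt1 !eqxx.
    rewrite (eq_bigr (fun=> n u * n v / #|P|%:R / M)); last first.
      move=> t /andP[/andP[tS /eqP wt] /eqP[yt zt]].
      rewrite /ratio (nz v); congr (_%:R * _%:R / _%:R / _%:R);
        apply: eq_card => t'; by rewrite !inE ?xpair_eqE ?wt ?yt ?zt ?andbA.
    rewrite (eq_bigl (mem P)); last by move=> t; rewrite !inE xpair_eqE.
    by rewrite sumr_const -[LHS]mulr_natr [LHS]mulrAC divfK.
  rewrite -(pair_big_dep xpredT E (fun u v => n u * n v / M)) /=.
  apply: eq_big => [u|u _]; first by rewrite inE.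
  by rewrite mulr_suml; apply: eq_bigl => v; rewrite inE.
rewrite (eq_bigl (mem Q)); last by move=> t; rewrite !inE.
rewrite sumr_const -mulr_natl -/M ler_pdivrMr // /c mulrAC mulrA.
by rewrite ler_pdivlMr ?ltr0n // mulrC (mulrC _ m.+1%:R) -expr2.
Qed.

(** * Ordered edges and the entropy of their prefixes *)

Definition orderings (V : finType) (r : nat) (E : {set {set V}}) :
    {set {ffun 'I_r -> V}} :=
  [set t : {ffun 'I_r -> V} | injectiveb t & [set t i | i : 'I_r] \in E].

Lemma card_orderings (V : finType) (r : nat) (E : {set {set V}}) :
  {in E, forall e : {set V}, #|e| = r} -> #|orderings r E| = (r`! * #|E|)%N.
Proof.
move=> Er; rewrite -sum1_card mulnC -sum_nat_const.
rewrite (partition_big (fun t : {ffun 'I_r -> V} => [set t i | i : 'I_r]) (mem E)).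
  apply: eq_bigr => e eE.
  transitivity (#|e| ^_ #|'I_r|); last by rewrite card_ord (Er e eE) ffactnn.
  rewrite -(card_inj_ffuns_on _ (mem e)) -sum1_card; apply: eq_bigl => t.
  rewrite !inE; apply/andP/andP.
    move=> [/andP[-> _] /eqP te]; split=> //; apply/forallP => i.
    by have : t i \in e by rewrite -te imset_f.
  move=> [/forallP te /injectiveP ti]; have {}te : [set t i | i : 'I_r] = e.
    apply/eqP; rewrite eqEcard card_imset // card_ord (Er e eE) leqnn andbT.
    by apply/subsetP => _ /imsetP[i _ ->]; apply: te.
  by rewrite te eqxx; split=> //; apply/andP; split=> //; apply/injectiveP.
by move=> t; rewrite inE => /andP[].
Qed.

(** Later positions are masked by [None], so that prefixes of all lengths live in one finite
    type. *)
Definition prefix_of (V : finType) (r k : nat) (t : {ffun 'I_r -> V}) :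
    {ffun 'I_r -> option V} :=
  [ffun j : 'I_r => if (j < k)%N then Some (t j) else None].

Lemma eq_prefixP (V : finType) (r k : nat) (t t' : {ffun 'I_r -> V}) :
  reflect (forall j : 'I_r, (j < k)%N -> t j = t' j)
          (prefix_of k t == prefix_of k t').
Proof.
apply: (iffP eqP) => [/ffunP e j jk | e].
  by have := e j; rewrite !ffunE jk => -[].
by apply/ffunP => j; rewrite !ffunE; case: ifP => // /e ->.
Qed.

Lemma eq_prefixS (V : finType) (r : nat) (k : 'I_r) (t t' : {ffun 'I_r -> V}) :
  (prefix_of k.+1 t == prefix_of k.+1 t') =
  (prefix_of k t == prefix_of k t') && (t k == t' k).
Proof.
apply/eq_prefixP/andP => [e|[/eq_prefixP e /eqP ek] j].
  by split; [apply/eq_prefixP => j jk; apply: e; apply: ltnW | rewrite e].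
by rewrite ltnS leq_eqVlt => /orP[/eqP/val_inj-> //|/e].
Qed.

Section PrefixEntropy.
Variables (R : realType) (V : finType) (E : {set {set V}}) (G : rel V).
Variables (l p : nat).
Hypothesis pl : (p < l)%N.
Hypothesis EG : {in E, forall e : {set V}, {in e &, forall u v, u != v -> G u v}}.
Hypothesis Gl : forall C : {set V},
  {in C &, forall u v, u != v -> G u v} -> (#|C| <= l)%N.

Let S := orderings p.+1 E.

Let orderings_adj t i j : t \in S -> t i != t j -> G (t i) (t j).
Proof. by rewrite inE => /andP[_ tE]; apply: (EG tE); apply: imset_f. Qed.

Let orderings_inj t : t \in S -> injective t.
Proof. by rewrite inE => /andP[/injectiveP]. Qed.

(** This is |S| H(X | X_1, ..., X_k) for X uniform in [S], because X is uniform on its fibre once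
    the prefix is known. The drop from [k] to [k.+1] is therefore |S| h_(k+1). *)
Definition prefix_log (k : nat) : R :=
  \sum_(t in S) ln (#|fiber S (prefix_of k) t|%:R : R).

Lemma prefix_log0 : prefix_log 0 = #|S|%:R * ln (#|S|%:R : R).
Proof.
rewrite mulr_natl -sumr_const; apply: eq_bigr => t tS; congr (ln _%:R).
apply: eq_card => t'; rewrite !inE; apply: andb_idr => _.
by apply/eq_prefixP.
Qed.

Lemma prefix_log_full : prefix_log p.+1 = 0.
Proof.
rewrite /prefix_log big1 // => t tS; rewrite (_ : #|_| = 1%N) ?ln1 //.
rewrite -(cards1 t); apply: eq_card => t'; rewrite [in RHS]inE inE.
apply/andP/eqP => [[_ /eq_prefixP e]|->]; last by rewrite eqxx.
by apply/ffunP => j; apply: e.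
Qed.

(** The left side is |S| (h_(k+2) - h_(k+1)). In [cond_entropy_step], [w] is the prefix of length
    [k], while [y] and [z] are the next two entries; transposing them is allowed since edges are
    unordered. *)
Lemma prefix_log_step (k : nat) : (k.+1 < p.+1)%N ->
  prefix_log k.+1 + prefix_log k.+1 - prefix_log k.+2 - prefix_log k
    <= #|S|%:R * ln ((l - k.+1)%:R / (l - k)%:R : R).
Proof.
move=> kp; pose a : 'I_p.+1 := Ordinal (ltnW kp); pose b := Ordinal kp.
have ab : a != b by rewrite -val_eqE /= ltn_eqF.
pose s (t : {ffun 'I_p.+1 -> V}) := [ffun j => t (tperm a b j)].
have sK : involutive s by move=> t; apply/ffunP => j; rewrite !ffunE tpermK.
have sS t : t \in S -> s t \in S.
  rewrite !inE => /andP[/injectiveP ti tE]; apply/andP; split.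
    by apply/injectiveP => i j; rewrite !ffunE => /ti /perm_inj.
  rewrite (_ : [set s t i | i : 'I_p.+1] = [set t i | i : 'I_p.+1]) //.
  apply/setP => v; apply/imsetP/imsetP => -[j _ ->].
    by exists (tperm a b j); rewrite ?ffunE.
  by exists (tperm a b j); rewrite ?ffunE ?tpermK.
have sw t : prefix_of k (s t) = prefix_of k t.
  apply/eqP/eq_prefixP => j jk; rewrite ffunE tpermD //.
    by rewrite -val_eqE /= gtn_eqF.
  by rewrite -val_eqE /= gtn_eqF // ltnW.
have sa t : s t a = t b by rewrite ffunE tpermL.
have sb t : s t b = t a by rewrite ffunE tpermR.
have lk : (l - k = (l - k.+2).+2)%N by lia.
have lk1 : (l - k.+1 = (l - k.+2).+1)%N by lia.
rewrite lk lk1.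
have := @cond_entropy_step R _ _ V S (prefix_of k)
  (fun t => t a) (fun t => t b) s (l - k.+2).
rewrite !sumrB big_split /= => h.
rewrite (_ : prefix_log k.+1 + prefix_log k.+1 - prefix_log k.+2 - prefix_log k = 
  (\sum_(i in S)
      ln #|fiber S (fun t => (prefix_of k t, t a)) i|%:R +
    \sum_(i in S)
       ln #|fiber S (fun t => (prefix_of k t, t b)) i|%:R -
    \sum_(i in S)
       ln #|fiber S (fun t => (prefix_of k t, t a, t b)) i|%:R -
    \sum_(i in S) ln #|fiber S (prefix_of k) i|%:R)).
  apply: h => [t tS|t tS|t0 C t0S hC].
  - by split=> //; exact: sS.
  - by apply: contra_neq ab => /orderings_inj; apply.
  (* The required bound is at least 2, so [C] may be taken to have two elements. Each of them then
     continues the prefix of [t0], so it differs from the [k] entries of that prefix and is adjacent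
     to them; [C] together with [D] is a clique of [G]. *)
  have [C1|C1] := leqP #|C| 1; first exact: leq_trans C1 _.
  have hC1 u : u \in C -> exists2 t, t \in S & prefix_of k t = prefix_of k t0 /\ t a = u.
    move=> uC; have /card_gt0P[v] : (0 < #|C :\ u|)%N.
      by move: C1; rewrite (cardsD1 u) uC.
    rewrite !inE => /andP[vu vC]; have [|t [tS tt0 ta _]] := hC _ _ uC vC.
      by rewrite eq_sym.
    by exists t.
  pose D := [set t0 j | j : 'I_p.+1 & (j < k)%N].
  have CD : [disjoint C & D].
    apply/pred0P => u; apply/negbTE/negP => /andP[/= /hC1[t tS [/eqP/eq_prefixP tt0 <-]]].
    move=> /imsetP[j]; rewrite inE => jk; rewrite -tt0 // => /(orderings_inj tS) aj.
    by move: jk; rewrite -aj ltnn.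
  have Dk : #|D| = k.
    rewrite card_imset; last exact: orderings_inj.
    have wi : injective (widen_ord (ltnW (ltnW kp))).
      by move=> i j /(congr1 val) /= ij; apply: val_inj.
    rewrite -[RHS]card_ord -(card_imset _ wi).
    apply: eq_card => j; rewrite inE; apply/idP/imsetP => [jk|[i _ ->] /=].
      by exists (Ordinal jk) => //; apply: val_inj.
    exact: ltn_ord.
  rewrite -lk leq_subRL; last by rewrite ltnW // ltnW // (leq_trans kp).
  rewrite -{1}Dk addnC -cardsUI (disjoint_setI0 CD) cards0 addn0.
  apply: Gl => u v; rewrite !inE => /orP[uC|uD] /orP[vC|vD].
  - move=> uv; have [t [tS _ <- <-]] := hC _ _ uC vC uv; apply: orderings_adj => //.
    by apply: contra_neq ab => /orderings_inj; apply.
  - have [t tS [/eqP/eq_prefixP tt0 <-]] := hC1 _ uC.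
    move: vD => /imsetP[j]; rewrite inE => jk ->; rewrite -tt0 //.
    exact: orderings_adj.
  - have [t tS [/eqP/eq_prefixP tt0 <-]] := hC1 _ vC.
    move: uD => /imsetP[j]; rewrite inE => jk ->; rewrite -tt0 //.
    exact: orderings_adj.
  - by move: uD vD => /imsetP[i _ ->] /imsetP[j _ ->]; apply: orderings_adj.
have fa t : fiber S (fun t => (prefix_of k t, t a)) t = fiber S (prefix_of k.+1) t.
  by apply: eq_fiber => t'; rewrite xpair_eqE -(eq_prefixS a).
have fab t : fiber S (fun t => (prefix_of k t, t a, t b)) t = fiber S (prefix_of k.+2) t.
  by apply: eq_fiber => t'; rewrite !xpair_eqE -(eq_prefixS a) -(eq_prefixS b).
congr (_ + _ - _ - _); try by apply: eq_bigr => t _; rewrite ?fa ?fab.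
(* The fibres with [t b] in place of [t a] are the images under [s] of those of the prefix of length
   [k.+1]. *)
rewrite [RHS](reindex_inj (inv_inj sK)); apply: eq_big => [t|t tS].
  by apply/idP/idP => [/sS //|/sS]; rewrite sK.
congr (ln _%:R); rewrite -fa -(card_imset _ (inv_inj sK)).
apply: eq_card => t'; rewrite [in RHS]inE; apply/imsetP/andP => [[t1]|[t'S e]].
  rewrite inE => /andP[t1S]; rewrite !xpair_eqE => e ->.
  by rewrite sS // !sw !sb.
exists (s t'); last by rewrite sK.
by move: e; rewrite inE sS // !xpair_eqE sw sa sw sb.
Qed.

End PrefixEntropy.

(** The first [p] entries of an ordered edge are an ordering of a [p]-subset of that edge; [ext]
    pads this ordering with [None] to recover the prefix. *)
Lemma card_prefix_image (V : finType) (p : nat) (E D : {set {set V}}) :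
  {in E, forall e A : {set V}, A \subset e -> #|A| = p -> A \in D} ->
  {in D, forall A : {set V}, #|A| = p} ->
  (#|prefix_of p @: orderings p.+1 E| <= p`! * #|D|)%N.
Proof.
move=> ED Dp; rewrite -(card_orderings Dp).
pose ext (g : {ffun 'I_p -> V}) : {ffun 'I_p.+1 -> option V} :=
  [ffun j : 'I_p.+1 => omap g (insub (val j))].
apply: leq_trans (leq_imset_card ext _); apply/subset_leq_card/subsetP => x.
move=> /imsetP[t]; rewrite inE => /andP[/injectiveP ti tE] ->.
pose g := [ffun j : 'I_p => t (widen_ord (leqnSn p) j)].
have gi : injective g.
  move=> i j; rewrite !ffunE => /ti e; apply: val_inj.
  exact: (congr1 (@nat_of_ord _) e).
apply/imsetP; exists g.
  rewrite inE; apply/andP; split; first exact/injectiveP.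
  apply: (ED _ tE); last by rewrite card_imset // card_ord.
  by apply/subsetP => _ /imsetP[j _ ->]; rewrite ffunE imset_f.
apply/ffunP => j; rewrite !ffunE; case: insubP => [i jp ij|/negbTE-> //].
by rewrite jp /= ffunE; congr (Some (t _)); apply: val_inj.
Qed.

Lemma edges_shadow_ineq (R : realType) (V : finType) (E D : {set {set V}})
    (G : rel V) (l p : nat) :
  (0 < p < l)%N ->
  {in E, forall e : {set V}, #|e| = p.+1} ->
  {in E, forall e A : {set V}, A \subset e -> #|A| = p -> A \in D} ->
  {in D, forall A : {set V}, #|A| = p} ->
  {in E, forall e : {set V}, {in e &, forall u v, u != v -> G u v}} ->
  (forall C : {set V}, {in C &, forall u v, u != v -> G u v} -> (#|C| <= l)%N) ->
  (p.+1`! * #|E|)%:R ^+ p * (l ^_ p)%:R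
    <= (l - p)%:R ^+ p * (p`! * #|D|)%:R ^+ p.+1 :> R.
Proof.
move=> /andP[p0 pl] Ep ED Dp EG Gl; rewrite -(card_orderings Ep).
set S := orderings p.+1 E; set n : R := #|S|%:R.
(* Without edges the left side is 0, as [p] is positive. Otherwise all quantities are positive and
   logarithms can be taken. *)
have [S0|[t0 t0S]] := set_0Vmem S.
  rewrite /n S0 cards0 expr0n eqn0Ngt p0 mul0r.
  by rewrite mulr_ge0 // exprn_ge0.
have n0 : 0 < n by rewrite ltr0n; apply/card_gt0P; exists t0.
have sle := card_prefix_image ED Dp.
have ent := entropy_le_ln_card R S (prefix_of p).
have s1 : (0 < #|prefix_of p @: S|)%N.
  by apply/card_gt0P; exists (prefix_of p t0); apply: imset_f.
have s0 : (0 < p`! * #|D|)%N := leq_trans s1 sle.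
set s : R := (p`! * #|D|)%:R; have {}s0 : 0 < s by rewrite ltr0n.
have {}ent : n * ln n - prefix_log R E p p <= n * ln s.
  apply: le_trans ent _; rewrite ler_pM2l // ler_ln ?posrE // ?ltr0n //.
  by rewrite ler_nat.
pose a := prefix_log R E p.
have a0 : a 0 = n * ln n := prefix_log0 R E p.
have ap : a p.+1 = 0 := prefix_log_full R E p.
have step k : (k.+1 < p.+1)%N ->
    a k.+1 + a k.+1 - a k.+2 - a k <= n * ln ((l - k.+1)%:R / (l - k)%:R).
  by move=> kp; apply: (prefix_log_step R pl EG Gl kp).
rewrite -/(a p) in ent; clearbody a n s.
(* [b k] is [n] times h_(k+1); the last one, [b p], is [a p]. *)
pose b k := a k - a k.+1.
have q0 k : (k <= p)%N -> 0 < (l - k)%:R :> R.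
  by move=> kp; rewrite ltr0n subn_gt0 (leq_ltn_trans kp).
(* Adding [step] from [k] up to p - 1 makes the quotients telescope to (l - p) / (l - k). *)
have tele k : (k <= p)%N -> b p <= b k + n * ln ((l - p)%:R / (l - k)%:R).
  move=> kp; rewrite -(subKn kp); elim: (p - k)%N (leq_subr k p) => [|d IHd] dp.
    by rewrite subn0 divff ?ln1 ?mulr0 ?addr0 // gt_eqF // q0.
  have {IHd} := IHd (ltnW dp).
  have kE : (p - d = (p - d.+1).+1)%N by lia.
  rewrite kE; have {kE} kp' : ((p - d.+1).+1 < p.+1)%N by lia.
  move: (p - d.+1)%N kp' => j jp IHd; have := step _ jp; move: IHd.
  have := @q0 j; have := @q0 j.+1; have := @q0 p; move=> /(_ (leqnn p)) qp.
  move=> /(_ (jp : (j.+1 <= p)%N)) qj1 /(_ (ltnW (jp : (j.+1 <= p)%N))) qj.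
  rewrite !ln_div ?posrE // /b.
  move: (ln _) (ln _) (ln _) => x y z.
  lra.
have bp : b p = a p by rewrite /b ap subr0.
have : a p *+ p <= \sum_(k < p) b k + n * \sum_(k < p) ln ((l - p)%:R / (l - k)%:R).
  have -> : a p *+ p = \sum_(k < p) b p by rewrite sumr_const card_ord bp.
  rewrite mulr_sumr -big_split.
  by apply: ler_sum => k _; apply: tele; apply: ltnW.
have -> : \sum_(k < p) b k = n * ln n - a p.
  rewrite -a0 -[LHS]opprK -sumrN (eq_bigr (fun k : 'I_p => a k.+1 - a k)); last first.
    by move=> k _; rewrite opprB.
  by rewrite -(big_mkord xpredT (fun k => a k.+1 - a k)) telescope_sumr // opprB.
have ff0 : 0 < (l ^_ p)%:R :> R by rewrite ltr0n ffact_gt0 ltnW.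
have -> : \sum_(k < p) ln ((l - p)%:R / (l - k)%:R) =
    ln (l - p)%:R *+ p - ln (l ^_ p)%:R :> R.
  rewrite (eq_bigr (fun k : 'I_p => ln (l - p)%:R - ln (l - k)%:R)); last first.
    by move=> k _; rewrite ln_div // posrE q0 // ltnW.
  rewrite sumrB sumr_const card_ord; congr (_ - _).
  rewrite ffact_prod natr_prod.
  suff [] : 0 < \prod_(k < p) (l - k)%:R :> R /\
    \sum_(k < p) ln (l - k)%:R = ln (\prod_(k < p) (l - k)%:R) :> R by [].
  elim/big_rec2: _ => [|k x y _ [x0 ->]]; first by rewrite ltr01 ln1.
  by rewrite mulr_gt0 ?lnM ?posrE ?q0 // ltnW.
move=> main.
have lp0 : 0 < (l - p)%:R :> R by apply: q0.
rewrite -ler_ln ?posrE ?mulr_gt0 ?exprn_gt0 // !lnM ?posrE ?exprn_gt0 //.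
rewrite !lnXn // mulrS -(ler_pM2l n0).
move: main ent; rewrite -[ln n *+ p]mulr_natl -[ln s *+ p]mulr_natl.
rewrite -[ln _ *+ p]mulr_natl -[a p *+ p]mulr_natl => main ent.
(* [ent] is used p + 1 times: once to bound the sum of the [b k] in [main], and [p] times here to
   eliminate [a p]. This produces the exponent p + 1 of the shadow. *)
have : p%:R * (n * ln n - a p) <= p%:R * (n * ln s) by apply: ler_wpM2l.
lra.
Qed.

(** * Deleting the light pairs *)

(** An edge is chosen for each pair of core vertices in turn, avoiding the rest of the core and all
    earlier edges. The bound on [Z] is the number of core vertices plus [r] for each pair. *)
Lemma expansion_embedding (r m : nat) (H : hypergraph) (c : 'I_m.+1 -> vertex H) :
  (2 <= r)%N -> uniform r H -> injective c ->
  (forall i j (Z : {set vertex H}), i != j ->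
     (#|Z| <= m.+1 + #|Kedge m.+1| * r)%N -> c i \notin Z -> c j \notin Z ->
     exists e, [/\ e \in edges H, c i \in e, c j \in e & [disjoint e & Z]]) ->
  contains_copy (clique_expansion m.+1 r) H.
Proof.
move=> r2 Hr cI hc; set V := vertex H; pose core : {set V} := [set c i | i : 'I_m.+1].
have greedy (s : seq (Kedge m.+1)) : (size s <= #|Kedge m.+1|)%N ->
  exists g : Kedge m.+1 -> {set V},
    [/\ {in s, forall e, g e \in edges H},
        {in s, forall e, g e :&: core = c @: val e} &
        {in s &, forall e e', e != e' -> g e :&: g e' \subset core}].
  elim: s => [|e0 s IHs] /= sz; first by exists (fun=> set0).
  have [g [gE gc gg]] := IHs (ltnW sz).
  have [es|es] := boolP (e0 \in s).
    exists g; split=> [e|e|e e']; rewrite !inE;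
      try by move=> /predU1P[->|]; auto.
    by move=> /predU1P[->|es1] /predU1P[->|es2]; apply: gg.
  have e02 : #|val e0| == 2 := valP e0; move/cards2P: e02 => [i [j [ij eij]]].
  (* The current pair is removed from the forbidden set because the new edge must contain it.
     Avoiding the rest makes this edge meet the core in the pair alone and earlier edges only inside
     the core. *)
  pose Z := (core :|: \bigcup_(e <- s) g e) :\: c @: val e0.
  have cZ k : k \in val e0 -> c k \notin Z by move=> ke; rewrite inE imset_f.
  have [|||f [fE fi fj fZ]] := hc i j Z ij.
  - apply: leq_trans (subset_leq_card (subsetDl _ _)) _.
    apply: leq_trans (leq_card_setU _ _) _; apply: leq_add.
      by apply: leq_trans (leq_imset_card _ _) _; rewrite card_ord.
    apply: (@leq_trans (size s * r)); last by rewrite leq_mul2r ltnW ?orbT.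
    elim: s gE {IHs sz gc gg es Z cZ} => [|e s IHs] gE.
      by rewrite big_nil cards0.
    rewrite big_cons; apply: leq_trans (leq_card_setU _ _) _.
    rewrite /= mulSn leq_add ?IHs //.
      by rewrite (Hr _ (gE e _)) // mem_head.
    by move=> e' e's; apply: gE; rewrite inE e's orbT.
  - by apply: cZ; rewrite eij set21.
  - by apply: cZ; rewrite eij set22.
  have fnZ x : x \in f -> x \notin Z by move=> xf; rewrite (disjointFr fZ).
  have fcore : f :&: core = c @: val e0.
    apply/eqP; rewrite eqEsubset; apply/andP; split; apply/subsetP => x.
      rewrite inE => /andP[/fnZ xZ xc]; apply: contraR xZ => xe.
      by rewrite !inE xe xc.
    rewrite eij => /imsetP[k]; rewrite !inE => /orP[]/eqP-> ->;
      by rewrite ?fi ?fj imset_f.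
  have fg e : e \in s -> f :&: g e \subset core.
    move=> e_s; apply/subsetP => x; rewrite inE => /andP[xf xg].
    apply: contraR (fnZ _ xf) => xc; rewrite !inE (negbTE xc) /=.
    apply/andP; split; first by apply: contra xc; rewrite -fcore inE => /andP[].
    by rewrite (big_rem _ e_s) /= inE xg.
  have nes e : e \in s -> e == e0 = false.
    by move=> e_s; apply: contraNF es => /eqP <-.
  exists (fun e => if e == e0 then f else g e); split=> [e|e|e e'].
  - by rewrite inE; case: eqP => //= _; apply: gE.
  - by rewrite inE; case: eqP => [->|] //= _; apply: gc.
  - rewrite !inE => /predU1P[->|es1] /predU1P[->|es2]; rewrite ?eqxx ?nes //.
    + by move=> _; apply: fg.
    + by move=> _; rewrite setIC; apply: fg.
    + exact: gg.
have [|g [gE gc gg]] := greedy (enum (Kedge m.+1)); first by rewrite -cardE.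
have {}gE e : g e \in edges H by apply: gE; rewrite mem_enum.
have {}gc e : g e :&: core = c @: val e by apply: gc; rewrite mem_enum.
have {}gg e e' : e != e' -> g e :&: g e' \subset core.
  by apply: gg; rewrite mem_enum.
(* Outside the core each chosen edge has exactly r - 2 vertices, which become the images of the
   added vertices. *)
have gcard e : #|g e :\: core| = (r - 2)%N.
  by rewrite cardsD gc card_imset // (eqP (valP e)) (Hr _ (gE e)).
pose x0 := c ord0.
pose F (x : expansion_vertex m.+1 r) : V := match x with
  | inl i => c i
  | inr (e, j) => nth x0 (enum (g e :\: core)) j
  end.
have Fin e j : F (inr (e, j)) \in g e :\: core.
  by rewrite -mem_enum mem_nth // -cardE gcard.
have ccore i : c i \in core by apply: imset_f.
have FI : injective F.
  move=> [i|[e j]] [i'|[e' j']].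
  - by move=> /cI->.
  - by move=> h; have := Fin e' j'; rewrite -h inE ccore.
  - by move=> h; have := Fin e j; rewrite h inE ccore.
  - move=> h; have := Fin e j; rewrite inE => /andP[nc ge].
    have := Fin e' j'; rewrite -h inE => /andP[_ ge'].
    have [ee|ee] := eqVneq e e'; last first.
      by case/negP: nc; apply: (subsetP (gg _ _ ee)); rewrite inE ge.
    subst e'; congr (inr (e, _)); apply: val_inj; apply/eqP.
    have sz (k : 'I_(r - 2)) : (k < size (enum (g e :\: core)))%N.
      by rewrite -cardE gcard.
    by rewrite -(nth_uniq x0 (sz j) (sz j') (enum_uniq _)); apply/eqP.
exists F; split=> // A AF; have Ar := clique_expansion_uniform r2 AF.
move: AF Ar => /imsetP[e _ ->] Ar.
rewrite (_ : F @: _ = g e) //; apply/eqP; rewrite eqEcard; apply/andP; split.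
  apply/subsetP => _ /imsetP[x xe ->]; move: xe; rewrite inE.
  move=> /orP[/imsetP[i ie ->]|/imsetP[j _ ->]].
    have : c i \in g e :&: core by rewrite gc imset_f.
    by rewrite inE => /andP[].
  by have := Fin e j; rewrite inE => /andP[].
by rewrite (Hr _ (gE e)) card_imset // Ar.
Qed.

Lemma card_bigcup_leq (I T : finType) (P : pred I) (F : I -> {set T}) :
  (#|\bigcup_(i | P i) F i| <= \sum_(i | P i) #|F i|)%N.
Proof.
elim/big_rec2: _ => [|i x y _ h]; first by rewrite cards0.
by apply: leq_trans (leq_card_setU _ _) _; rewrite leq_add2l.
Qed.

Lemma ffact_leq_exp (n k : nat) : (n ^_ k <= n ^ k)%N.
Proof.
rewrite ffact_prod -[X in (_ <= _ ^ X)%N]card_ord -prod_nat_const.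
by apply: leq_prod => i _; apply: leq_subr.
Qed.

Lemma bin_leq_exp (n k : nat) : ('C(n, k) <= n ^ k)%N.
Proof.
apply: leq_trans (ffact_leq_exp n k).
by rewrite -bin_ffact leq_pmulr // fact_gt0.
Qed.

Lemma card_supersets_leq (V : finType) (A : {set V}) (k : nat) :
  (#|[set e : {set V} | A \subset e & #|e| == #|A| + k]| <= #|V| ^ k)%N.
Proof.
pose f (e : {set V}) := e :\: A.
rewrite -(card_in_imset (f := f)); last first.
  move=> e e'; rewrite !inE => /andP[/setIidPr eA _] /andP[/setIidPr e'A _] ee.
  by rewrite -(setID e A) -(setID e' A) eA e'A -/(f e) ee.
apply: (@leq_trans #|[set e : {set V} | #|e| == k]|).
  apply/subset_leq_card/subsetP => x /imsetP[e]; rewrite inE.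
  by move=> /andP[/setIidPr eA /eqP ec] ->; rewrite inE cardsD eA ec addKn.
by rewrite card_draws bin_leq_exp.
Qed.

Definition light_pair (V : finType) (E : {set {set V}}) (B : nat) (u v : V) :=
  [exists Z : {set V}, [&& (#|Z| <= B)%N, u \notin Z, v \notin Z &
    [forall e in E, (u \in e) && (v \in e) ==> ~~ [disjoint e & Z]]]].

Lemma heavy_pair (V : finType) (E : {set {set V}}) (B : nat) (u v : V)
    (Z : {set V}) :
  ~~ light_pair E B u v -> (#|Z| <= B)%N -> u \notin Z -> v \notin Z ->
  exists e, [/\ e \in E, u \in e, v \in e & [disjoint e & Z]].
Proof.
move=> /existsPn/(_ Z) h ZB uZ vZ; move: h; rewrite ZB uZ vZ /=.
move=> /forallPn[e] /=; rewrite 2!negb_imply negbK => /and3P[eE /andP[ue ve] eZ].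
by exists e.
Qed.

(** An edge containing a light pair also meets the blocking set of that pair. Two vertices of the
    pair, one of at most [B] blocking vertices and [k] further vertices determine the edge. *)
Lemma card_light_edges (V : finType) (E : {set {set V}}) (B k : nat) :
  {in E, forall e : {set V}, #|e| = k.+3} ->
  (#|[set e in E | [exists u in e, exists v in e, (u != v) && light_pair E B u v]]|
     <= B * #|V| ^ k.+2)%N.
Proof.
move=> Ek.
pose Q (p : V * V) (Z : {set V}) := [&& (#|Z| <= B)%N, p.1 \notin Z, p.2 \notin Z &
    [forall e in E, (p.1 \in e) && (p.2 \in e) ==> ~~ [disjoint e & Z]]].
(* One blocking set is fixed for each ordered pair; the default is empty, for pairs with equal
   entries or without a blocking set. *)
pose zf (p : V * V) := if p.1 == p.2 then finset.set0 else odflt finset.set0 [pick Z | Q p Z].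
have zfP p : (#|zf p| <= B)%N /\ {in zf p, forall z, #|[set p.1; p.2; z]| = 3}.
  rewrite /zf; case: eqP => [_|/eqP p12].
    by rewrite cards0; split=> // z; rewrite inE.
  case: pickP => [Z /and4P[ZB p1 p2 _]|_] /=; last first.
    by rewrite cards0; split=> // z; rewrite inE.
  split=> // z zZ; rewrite setUC cardsU1 cards2 p12 !inE negb_or.
  by rewrite (memPn p1 _ zZ) (memPn p2 _ zZ).
apply: (@leq_trans #|\bigcup_(p : V * V) \bigcup_(z in zf p)
    [set e : {set V} | [set p.1; p.2; z] \subset e & #|e| == k.+3]|).
  apply/subset_leq_card/subsetP => e; rewrite inE => /andP[eE].
  move=> /existsP[u /andP[ue /existsP[v /and3P[ve uv luv]]]].
  apply/bigcupP; exists (u, v) => //; rewrite /zf (negbTE uv) /=.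
  case: pickP => [Z /and4P[_ _ _ /forallP/(_ e)]|h]; last first.
    by case/existsP: luv => Z; have := h Z; rewrite /Q /= => ->.
  rewrite eE ue ve /= => /pred0Pn[z /andP[/= ze zZ]].
  apply/bigcupP; exists z => //; rewrite inE (Ek _ eE) eqxx andbT.
  by rewrite !subUset !sub1set ue ve ze.
apply: leq_trans (card_bigcup_leq _ _) _.
apply: (@leq_trans (\sum_(p : V * V) B * #|V| ^ k)); last first.
  by rewrite sum_nat_const card_prod mulnCA !expnS !mulnA.
apply: leq_sum => p _; apply: leq_trans (card_bigcup_leq _ _) _.
have [zB z3] := zfP p.
apply: (@leq_trans (\sum_(z in zf p) #|V| ^ k)); last first.
  by rewrite sum_nat_const leq_mul2r zB orbT.
by apply: leq_sum => z zp; have := card_supersets_leq [set p.1; p.2; z] k; rewrite z3.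
Qed.

(** [N] counts the edges without a light pair. Lightness is taken with respect to [B], the size of
    the forbidden sets in [expansion_embedding], so freeness rules out a clique of l + 1 vertices in
    the graph of heavy pairs. *)
Lemma free_edges_shadow_ineq (R : realType) (l r : nat) (H : hypergraph) :
  (3 <= r <= l)%N -> uniform r H -> is_free (clique_expansion l.+1 r) H ->
  exists N : nat,
    [/\ (N <= #|edges H|)%N,
        (#|edges H| <= N + (l.+1 + #|Kedge l.+1| * r) * nvert H ^ r.-1)%N &
        (r`! * N)%:R ^+ r.-1 * (l ^_ r.-1)%:R
          <= (l - r.-1)%:R ^+ r.-1 * (r.-1`! * #|shadow r H|)%:R ^+ r :> R].
Proof.
move=> /andP[r3 rl] Hr Hfree; set B := (_ + _ * r)%N.
case: r => [//|[//|[//|k]]] in r3 rl Hr Hfree B *.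
pose L := [set e in edges H |
  [exists u in e, exists v in e, (u != v) && light_pair (edges H) B u v]].
exists #|edges H :\: L|; split.
- exact/subset_leq_card/subsetDl.
- rewrite -(cardsID L (edges H)) addnC leq_add2l.
  apply: leq_trans (card_light_edges B (E := edges H) _); last by move=> e /Hr.
  exact/subset_leq_card/subsetIr.
apply: (@edges_shadow_ineq _ _ _ _ (fun u v => ~~ light_pair (edges H) B u v)).
- by rewrite ltn0Sn.
- by move=> e; rewrite inE => /andP[_ /Hr].
- move=> e; rewrite inE => /andP[_ eH] A Ae Ac; rewrite inE Ac eqxx /=.
  by apply/existsP; exists e; rewrite eH.
- by move=> A; rewrite inE => /andP[/eqP].
- move=> e; rewrite !inE => /andP[+ eH] u v ue ve uv; rewrite eH /=.
  by apply: contra => luv; apply/existsP; exists u; rewrite ue; apply/existsP;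
    exists v; rewrite ve uv.
move=> C CG; rewrite leqNgt; apply/negP => lC; apply: Hfree.
pose c (i : 'I_l.+1) : vertex H := enum_val (widen_ord lC i).
have cI : injective c.
  move=> i j /enum_val_inj e; apply: val_inj.
  exact: (congr1 (@nat_of_ord _) e).
apply: (expansion_embedding (c := c)) => // i j Z ij ZB ci cj.
apply: (heavy_pair (B := B)) => //; apply: CG; rewrite ?enum_valP //.
by rewrite (inj_eq cI).
Qed.

(** * Extremal constructions *)

(** First coordinates name the parts: these are the edges of the complete [l]-partite [s]-graph with
    parts of size [q]. *)
Definition rainbow (l q s : nat) : {set {set 'I_l * 'I_q}} :=
  [set A : {set 'I_l * 'I_q} | #|A| == s & #|[set p.1 | p in A]| == s].

(** An ordered rainbow set is an injective sequence of [s] parts with an arbitrary position in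
    each. *)
Lemma card_rainbow (l q s : nat) :
  (s`! * #|rainbow l q s| = l ^_ s * q ^ s)%N.
Proof.
rewrite -card_orderings; last by move=> A; rewrite inE => /andP[/eqP].
pose I := [set f : {ffun 'I_s -> 'I_l} | injectiveb f].
pose h (p : {ffun 'I_s -> 'I_l} * {ffun 'I_s -> 'I_q}) := [ffun i => (p.1 i, p.2 i)].
have hI : injective h.
  move=> [f g] [f' g'] /ffunP e.
  by congr pair; apply/ffunP => i; have := e i; rewrite !ffunE => -[].
transitivity #|h @: finset.setX I [set: {ffun 'I_s -> 'I_q}]|; last first.
  by rewrite card_imset // cardsX card_inj_ffuns cardsT card_ffun !card_ord.
apply: eq_card => t; rewrite !inE; apply/idP/imsetP.
  move=> /and3P[/injectiveP ti _ /eqP t1].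
  exists ([ffun i => (t i).1], [ffun i => (t i).2]); last first.
    by apply/ffunP => i; rewrite !ffunE; case: (t i).
  rewrite !inE andbT; apply/injectiveP => i j; rewrite !ffunE => e.
  have /imset_injP inj : #|[set p.1 | p in [set t i | i : 'I_s]]| ==
      #|[set t i | i : 'I_s]| by rewrite t1 card_imset // card_ord.
  by apply: ti; apply: inj; rewrite ?imset_f.
move=> [[f g]]; rewrite !inE andbT => /injectiveP fi ->.
have hi : injective (h (f, g)) by move=> i j; rewrite !ffunE => -[/fi].
apply/and3P; split; first exact/injectiveP.
  by rewrite card_imset // card_ord.
rewrite -imset_comp card_imset ?card_ord // => i j /=.
by rewrite !ffunE => /fi.
Qed.

Lemma rainbow_inj (l q s : nat) (A : {set 'I_l * 'I_q}) :
  A \in rainbow l q s -> {in A &, injective fst}.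
Proof. by rewrite inE => /andP[/eqP As /eqP A1]; apply/imset_injP; rewrite A1 As. Qed.

(** The [d] isolated vertices dilute the densities, so that smaller values of x are reached as
    well. *)
Definition multipartite (l r q d : nat) : hypergraph :=
  @Hypergraph ('I_l * 'I_q + 'I_d)%type
    [set [set inl p | p in A] | A : {set 'I_l * 'I_q} in rainbow l q r].

Lemma multipartite_uniform (l r q d : nat) : uniform r (multipartite l r q d).
Proof.
move=> e /imsetP[A]; rewrite inE => /andP[/eqP Ar _] ->.
by rewrite card_imset // => x y [].
Qed.

Lemma card_multipartite (l r q d : nat) :
  #|edges (multipartite l r q d)| = #|rainbow l q r|.
Proof. by rewrite card_imset //; apply: imset_inj => x y []. Qed.

Lemma card_shadow_multipartite (l r q d : nat) : (1 < r <= l)%N ->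
  #|shadow r (multipartite l r q d)| = #|rainbow l q r.-1|.
Proof.
move=> /andP[r1 rl]; have inlI : injective (@inl ('I_l * 'I_q)%type 'I_d) by move=> x y [].
rewrite -(card_imset _ (imset_inj inlI)); apply: eq_card => X.
apply/idP/imsetP.
  rewrite inE => /andP[/eqP Xr /existsP[_ /andP[/imsetP[A Ar ->] XA]]].
  pose A' := inl @^-1: X; have XA' : X = inl @: A'.
    apply/setP => x; apply/idP/imsetP => [xX|[y]]; last by rewrite inE => ? ->.
    have /imsetP[y yA xy] := subsetP XA _ xX.
    by exists y => //; rewrite inE -xy.
  exists A' => //; have A'r : #|A'| = r.-1 by rewrite -Xr XA' card_imset.
  rewrite inE A'r eqxx -A'r /=; apply/imset_injP => u v.
  rewrite !inE => uX vX; apply: (rainbow_inj Ar).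
    by have /imsetP[u' u'A [->]] := subsetP XA _ uX.
  by have /imsetP[u' u'A [->]] := subsetP XA _ vX.
move=> [A Ar ->]; move: (Ar); rewrite !inE => /andP[/eqP Ac /eqP A1].
rewrite card_imset // Ac eqxx /=.
(* To extend [A] to an edge, an element of [A] supplies a position [b], and [c] is a part that [A]
   misses since r - 1 < l. *)
have /card_gt0P[[a b] abA] : (0 < #|A|)%N by rewrite Ac; case: (r) r1 => [|[]].
have /card_gt0P[c] : (0 < #|~: [set p.1 | p in A]|)%N.
  by rewrite cardsCs setCK A1 card_ord subn_gt0; case: (r) r1 rl.
rewrite inE => cA.
have cbA : (c, b) \notin A by apply: contra cA => cbA; apply/imsetP; exists (c, b).
apply/existsP; exists [set inl p | p in (c, b) |: A]; apply/andP; split.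
  apply: imset_f; rewrite inE cardsU1 cbA Ac imsetU1 cardsU1 cA A1 /=.
  by rewrite add1n prednK ?eqxx // ltnW.
by apply: imsetS; apply: subsetUr.
Qed.

Definition kedge (m : nat) (i j : 'I_m) (ij : i != j) : Kedge m :=
  exist _ [set i; j] (introT eqP (etrans (cards2 i j) (congr1 (fun b : bool => b.+1) ij))).

Lemma inl_expansion_edge (m r : nat) (e : Kedge m) (i : 'I_m) :
  i \in val e -> (inl i : expansion_vertex m r) \in expansion_edge r e.
Proof. by move=> ie; rewrite inE imset_f. Qed.

(** Any two of the l + 1 core vertices share an edge of the expansion, so their images would lie in
    distinct parts, of which there are only [l]. *)
Lemma multipartite_free (l r q d : nat) : (0 < l)%N ->
  is_free (clique_expansion l.+1 r) (multipartite l r q d).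
Proof.
move=> l0 [f [fI fE]].
have edgeP (i j : 'I_l.+1) (ij : i != j) : exists2 A, A \in rainbow l q r &
    f (inl i) \in inl @: A /\ f (inl j) \in inl @: A.
  have /fE /imsetP[A Ar fA] : expansion_edge r (kedge ij) \in
    edges (clique_expansion l.+1 r) by apply: imset_f.
  by exists A => //; rewrite -fA; split; apply: imset_f; apply: inl_expansion_edge;
    rewrite ?set21 ?set22.
have pP i : exists p, f (inl i) = inl p.
  have [j ij] : exists j, i != j.
    have /card_gt0P[j] : (0 < #|[set~ i]|)%N by rewrite cardsC1 card_ord.
    by rewrite !inE eq_sym; exists j.
  by have [A _ [/imsetP[p _ ->] _]] := edgeP _ _ ij; exists p.
have [p hp] := choice pP.
suff /leq_card : injective (fst \o p) by rewrite !card_ord ltnn.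
move=> i j /= pij; apply/eqP; apply: contraT => ij.
have [A Ar []] := edgeP _ _ ij; rewrite !hp => /imsetP[u uA [pu]] /imsetP[w wA [pw]].
have uw : u = w by apply: (rainbow_inj Ar) => //; rewrite -pu -pw.
suff : inl i = inl j :> expansion_vertex l.+1 r by case=> e; rewrite e eqxx in ij.
by apply: fI; rewrite !hp pu pw uw.
Qed.

(** [None] is the common vertex of all edges and [L] is its link. *)
Definition star (n : nat) (L : {set {set 'I_n}}) : hypergraph :=
  @Hypergraph (option 'I_n) [set None |: Some @: A | A : {set 'I_n} in L].

Section Star.
Variables (n s : nat) (L : {set {set 'I_n}}).
Hypothesis Ls : {in L, forall A : {set 'I_n}, #|A| = s}.

Let some_inj : injective (@Some 'I_n). Proof. by move=> x y []. Qed.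

Let none_some (A : {set 'I_n}) : (None : option 'I_n) \notin Some @: A.
Proof. by apply/imsetP => -[]. Qed.

Lemma star_uniform : uniform s.+1 (star L).
Proof.
by move=> _ /imsetP[A AL ->]; rewrite cardsU1 none_some card_imset // Ls.
Qed.

Lemma card_star : #|edges (star L)| = #|L|.
Proof.
rewrite card_in_imset // => A B _ _ AB; apply: (imset_inj some_inj).
by rewrite -(setU1K (none_some A)) -(setU1K (none_some B)) AB.
Qed.

Lemma card_shadow_star_ge : (#|L| <= #|shadow s.+1 (star L)|)%N.
Proof.
rewrite -(card_imset _ (imset_inj some_inj)); apply/subset_leq_card/subsetP => X.
move=> /imsetP[A AL ->]; rewrite inE card_imset // Ls // eqxx /=.
apply/existsP; exists (None |: Some @: A); apply/andP; split.
  exact: imset_f.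
exact: subsetUr.
Qed.

(** A shadow set avoiding [None] is a member of the link; one containing [None] is determined by its
    other s - 1 vertices, which gives a term of lower order. *)
Lemma card_shadow_star_le : (#|shadow s.+1 (star L)| <= #|L| + 'C(n, s.-1))%N.
Proof.
pose D := [set B : {set 'I_n} | #|B| == s.-1].
have <- : #|D| = 'C(n, s.-1) by rewrite card_draws card_ord.
rewrite -(card_imset _ (imset_inj some_inj)).
have := leq_imset_card (fun B : {set 'I_n} => None |: Some @: B) (mem D).
rewrite -(leq_add2l #|(fun A : {set 'I_n} => Some @: A) @: L|); apply: leq_trans.
apply: leq_trans _ (leq_card_setU _ _); apply/subset_leq_card/subsetP => X.
rewrite inE /= => /andP[/eqP Xs /existsP[_ /andP[/imsetP[A AL ->] XA]]].
rewrite inE; have [XN|XN] := boolP (None \in X); apply/orP; [right|left].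
  pose B := Some @^-1: X; have XB : X = None |: Some @: B.
    apply/setP => -[x|]; rewrite !inE ?XN //=; apply/idP/imsetP => [xX|[y]].
      by exists x; rewrite ?inE.
    by rewrite inE => ? [->].
  apply/imsetP; exists B => //; rewrite inE -Xs XB cardsU1 none_some card_imset //.
apply/imsetP; exists A => //; apply/eqP.
rewrite eqEcard card_imset // Ls // Xs leqnn andbT; apply/subsetP => x xX.
by have := subsetP XA _ xX; rewrite in_setU1 => /predU1P[xN|//]; rewrite -xN xX in XN.
Qed.

(** For m > 3 the edges 01 and 23 of the complete graph have disjoint expansions, yet each would
    need a vertex mapped to [None]. *)
Lemma star_free (m r : nat) : (3 < m)%N -> is_free (clique_expansion m r) (star L).
Proof.
move=> m3 [f [fI fE]].
have edgeP e : exists2 x, x \in expansion_edge r e & f x = None.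
  have /fE/imsetP[A _ fA] : expansion_edge r e \in
    edges (clique_expansion m r) by apply: imset_f.
  have : None \in f @: expansion_edge r e by rewrite fA setU11.
  by move=> /imsetP[x xe ->]; exists x.
pose o i (im : (i < 4)%N) : 'I_m := Ordinal (leq_trans im m3).
have o01 : @o 0%N isT != @o 1%N isT by [].
have o23 : @o 2%N isT != @o 3%N isT by [].
have [x x01 fx] := edgeP (kedge o01); have [y y23 fy] := edgeP (kedge o23).
have xy : x = y by apply: fI; rewrite fx fy.
subst y; move: x01 y23; rewrite !inE.
move=> /orP[/imsetP[i + ->]|/imsetP[j _ ->]] /orP[/imsetP[i' + e]|/imsetP[j' _ e]] //.
  by case: e => <-; rewrite !inE -!val_eqE /=; case: (val i) => [|[|[|[|]]]].
case: e => /setP/(_ (@o 0%N isT)) + _.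
by rewrite !inE -!val_eqE.
Qed.

End Star.

(** * Limits of densities *)

Local Open Scope classical_set_scope.
Local Open Scope ring_scope.

Section Limits.
Variables (R : realType).

Lemma cvg_powers (f : nat -> R) (a : R) (p : nat) :
  f @ \oo --> a -> (fun k => f k ^+ p) @ \oo --> a ^+ p.
Proof.
move=> fa; elim: p => [|p IHp].
  by under eq_fun do rewrite expr0; rewrite expr0; apply: cvg_cst.
by under eq_fun do rewrite exprS; rewrite exprS; apply: cvgM.
Qed.

Variables (v : nat -> nat).
Hypothesis voo : v @ \oo --> \oo.

Lemma cvg_inv_order : (fun k => (v k)%:R^-1) @ \oo --> (0 : R).
Proof.
apply: (cvg_comp v (fun n => n%:R^-1 : R) voo).
by rewrite -cvg_shiftS; apply: cvg_harmonic.
Qed.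

Lemma near_order_ge (m : nat) : \forall k \near \oo, (m <= v k)%N.
Proof. by have /cvgnyPge := voo; apply. Qed.

Lemma cvg_ffact_ratio (r : nat) :
  (fun k => (v k ^_ r)%:R / (v k)%:R ^+ r) @ \oo --> (1 : R).
Proof.
elim: r => [|r IHr].
  by under eq_fun do rewrite ffactn0 expr0 divr1; apply: cvg_cst.
have lim1 : (fun k => 1 - r%:R * (v k)%:R^-1) @ \oo --> (1 : R).
  rewrite -[X in _ --> X]subr0 -[X in _ --> _ - X](mulr0 r%:R).
  by apply: cvgB; [exact: cvg_cst|apply: cvgMr; exact: cvg_inv_order].
rewrite -[X in _ --> X]mulr1; apply: cvg_trans (cvgM IHr lim1).
apply: near_eq_cvg; near=> k.
have vr : (r.+1 <= v k)%N by near: k; apply: near_order_ge.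
rewrite /= ffactnSr natrM natrB 1?ltnW // exprSr.
have v0 : (v k)%:R != 0 :> R by rewrite pnatr_eq0 -lt0n (leq_trans _ vr).
by field; rewrite v0 expf_neq0.
Unshelve. all: by end_near. Qed.

(** The two normalizations differ by the factor (v)_r / v^r, which tends to 1. The second one fits
    counts of ordered edges. *)
Lemma cvg_densityP (u : nat -> nat) (r : nat) (c : R) :
  (fun k => (u k)%:R / 'C(v k, r)%:R) @ \oo --> c <->
  (fun k => (r`! * u k)%:R / (v k)%:R ^+ r) @ \oo --> c.
Proof.
have ffE k : (v k ^_ r)%:R = 'C(v k, r)%:R * r`!%:R :> R by rewrite -natrM bin_ffact.
have neq0 : \forall k \near \oo, ('C(v k, r)%:R != 0 :> R) /\ ((v k)%:R != 0 :> R).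
  near=> k; have vr : (r.+1 <= v k)%N by near: k; apply: near_order_ge.
  by rewrite !pnatr_eq0 -!lt0n bin_gt0 ltnW // (leq_trans _ vr).
have r0 : r`!%:R != 0 :> R by rewrite pnatr_eq0 -lt0n fact_gt0.
split=> lim.
  rewrite -[X in _ --> X]mulr1; apply: cvg_trans (cvgM lim (cvg_ffact_ratio r)).
  apply: near_eq_cvg; near=> k.
  have [C0 v0] : ('C(v k, r)%:R != 0 :> R) /\ ((v k)%:R != 0 :> R) by near: k.
  by rewrite /= ffE natrM; field; rewrite C0 expf_neq0.
rewrite -[X in _ --> X]divr1.
apply: cvg_trans (cvgM lim (cvgV (oner_neq0 _) (cvg_ffact_ratio r))).
apply: near_eq_cvg; near=> k.
have [C0 v0] : ('C(v k, r)%:R != 0 :> R) /\ ((v k)%:R != 0 :> R) by near: k.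
by rewrite /= ffE natrM; field; rewrite C0 r0 expf_neq0.
Unshelve. all: by end_near. Qed.

Lemma cvg_sublinear (a : R) (f : nat -> R) :
  (forall k, 0 <= f k <= a * (v k)%:R^-1) -> f @ \oo --> (0 : R).
Proof.
move=> fa; apply: (squeeze_cvgr (f := cst 0) (h := fun k => a * (v k)%:R^-1)).
- by near=> k; apply: fa.
- exact: cvg_cst.
by rewrite -[X in _ --> X](mulr0 a); apply: cvgMr; exact: cvg_inv_order.
Unshelve. all: by end_near. Qed.

End Limits.

(** * Bounds on the feasible region and points in it *)

Lemma feasible_ineq (R : realType) (l r : nat) (x z : R) :
  (3 <= r <= l)%N -> feasible_region R r (clique_expansion l.+1 r) (x, z) ->
  z ^+ r.-1 * (l ^_ r.-1)%:R <= (l - r.-1)%:R ^+ r.-1 * x ^+ r.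
Proof.
move=> rl [_ _ [H [Hr Hfree [[voo _ _]]]]] /=.
have r0 : (0 < r)%N by case/andP: rl => r3 _; apply: leq_trans r3.
have [N hN] := choice (fun k => free_edges_shadow_ineq R rl (Hr k) (Hfree k)).
pose v k := nvert (H k); change (v @ \oo --> \oo) in voo.
pose B := (l.+1 + #|Kedge l.+1| * r)%N.
move=> /(cvg_densityP voo (fun k => #|shadow r (H k)|)) hx.
move=> /(cvg_densityP voo (fun k => #|edges (H k)|)) hz.
(* [y] is the normalized number of edges kept after deletion. It differs from that of all edges by
   at most r! B / v, so it has the same limit. *)
pose y k : R := (r`! * N k)%:R / (v k)%:R ^+ r.
have hy : y @ \oo --> z.
  have -> : y = (fun k => (r`! * #|edges (H k)|)%:R / (v k)%:R ^+ r -
                 (r`! * (#|edges (H k)| - N k))%:R / (v k)%:R ^+ r).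
    apply/funext => k; rewrite -mulrBl -natrB; last by rewrite leq_mul2l leq_subr orbT.
    by rewrite -mulnBr subKn //; have [] := hN k.
  rewrite -[X in _ --> X]subr0; apply: cvgB => //.
  apply: (cvg_sublinear voo (a := (r`! * B)%:R)) => k.
  rewrite divr_ge0 ?exprn_ge0 //=.
  have [->|v0] := posnP (v k).
    by rewrite invr0 mulr0 expr0n eqn0Ngt r0 invr0 mulr0.
  have v0' : 0 < (v k)%:R :> R by rewrite ltr0n.
  rewrite -[X in _ ^+ X](prednK r0) exprS invfM mulrA mulrAC ler_pM2r ?invr_gt0 //.
  rewrite ler_pdivrMr ?exprn_gt0 // -natrX -natrM ler_nat -mulnA leq_mul2l.
  by apply/orP; right; rewrite leq_subLR; have [] := hN k.
apply: (ler_cvg_to (f := fun k => y k ^+ r.-1 * (l ^_ r.-1)%:R)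
  (g := fun k => (l - r.-1)%:R ^+ r.-1 *
     ((r.-1`! * #|shadow r (H k)|)%:R / (v k)%:R ^+ r.-1) ^+ r) (a := \oo)).
- by apply: cvgMl; apply: cvg_powers.
- by apply: cvgMr; apply: cvg_powers.
(* This is the finite inequality divided on both sides by v^(r (r - 1)). *)
near=> k; have [_ _] := hN k; rewrite /y !expr_div_n -!exprM (mulnC r.-1).
move=> h; rewrite mulrAC mulrA ler_wpM2r // invr_ge0 exprn_ge0 //.
Unshelve. all: by end_near. Qed.

(** Rounding down changes the numerator by less than 1, hence the ratio by at most 1 / v. *)
Lemma cvg_truncn_ratio (R : realType) (v : nat -> nat) (a : nat -> R) (x : R)
    (p : nat) :
  v @ \oo --> \oo -> (0 < p)%N -> (forall k, 0 <= a k) ->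
  (fun k => a k / (v k)%:R ^+ p) @ \oo --> x ->
  (fun k => (Num.truncn (a k))%:R / (v k)%:R ^+ p) @ \oo --> x.
Proof.
move=> voo p0 a0 ha.
have dE : (fun k => (Num.truncn (a k))%:R / (v k)%:R ^+ p : R) =
    (fun k => a k / (v k)%:R ^+ p - (a k - (Num.truncn (a k))%:R) / (v k)%:R ^+ p).
  by apply/funext => k; rewrite -mulrBl opprB addrC subrK.
rewrite dE -[X in _ --> X]subr0; apply: cvgB => //.
apply: (cvg_sublinear voo (a := 1)) => k; have /andP[tl tu] := truncn_itv (a0 k).
have [->|v0] := posnP (v k); first by rewrite expr0n eqn0Ngt p0 invr0 !mulr0 lexx.
have v1 : 1 <= (v k)%:R :> R by rewrite ler1n.
have vp0 : 0 < (v k)%:R ^+ p :> R by rewrite exprn_gt0 // ltr0n.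
rewrite divr_ge0 ?subr_ge0 ?(ltW vp0) //= ler_pM ?invr_ge0 ?subr_ge0 ?(ltW vp0) //.
  by rewrite lerBlDl natr1 ltW.
by rewrite lef_pV2 ?posrE ?ltr0n // -[leLHS]expr1 ler_weXn2l.
Qed.

(** [b] is the limiting fraction of vertices in each part; b l <= 1 says that the parts fit, and the
    remaining vertices are isolated. *)
Lemma feasible_multipartite (R : realType) (l r : nat) (b : R) :
  (3 <= r <= l)%N -> 0 <= b -> b * l%:R <= 1 ->
  feasible_region R r (clique_expansion l.+1 r)
    ((l ^_ r.-1)%:R * b ^+ r.-1, (l ^_ r)%:R * b ^+ r).
Proof.
move=> /andP[r3 rl] b0 bl.
have idoo : (id : nat -> nat) @ \oo --> \oo by apply: cvg_id.
pose q (k : nat) := Num.truncn (b * k%:R).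
pose H k := multipartite l r (q k) (k - l * q k).
have lq k : (l * q k <= k)%N.
  have /andP[qk _] := truncn_itv (mulr_ge0 b0 (ler0n R k)).
  rewrite -(ler_nat R) natrM; apply: le_trans (ler_wpM2l _ qk) _ => //.
  by rewrite mulrA [_ * b]mulrC ler_piMl.
have vH k : nvert (H k) = k.
  by rewrite /nvert card_sum card_prod !card_ord subnKC.
have qb : (fun k => (q k)%:R / k%:R) @ \oo --> b.
  apply: (cvg_truncn_ratio (p := 1) idoo) => [//|k|]; first exact: mulr_ge0.
  have bcst : (fun _ : nat => b) @ \oo --> b by apply: cvg_cst.
  apply: cvg_trans bcst; apply: near_eq_cvg; near=> k.
  by rewrite expr1 mulfK // pnatr_eq0 -lt0n; near: k; apply: (near_order_ge idoo 1).
have cvgs s : (fun k => (s`! * #|rainbow l (q k) s|)%:R / k%:R ^+ s)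
    @ \oo --> (l ^_ s)%:R * b ^+ s.
  under eq_fun do rewrite card_rainbow natrM natrX -mulrA -expr_div_n.
  by apply: cvgMr; apply: cvg_powers.
have in01 s : (l ^_ s)%:R * b ^+ s \in `[0, 1].
  rewrite in_itv /= mulr_ge0 ?exprn_ge0 //=.
  apply: (@le_trans _ _ (l%:R ^+ s * b ^+ s)).
    by rewrite ler_wpM2r ?exprn_ge0 // -natrX ler_nat ffact_leq_exp.
  by rewrite -exprMn mulrC exprn_ile1 // mulr_ge0.
have hx : (fun k => shadow_density R r (H k)) @ \oo --> (l ^_ r.-1)%:R * b ^+ r.-1.
  rewrite /shadow_density; under eq_fun do rewrite vH.
  apply/(cvg_densityP idoo); under eq_fun do
    rewrite card_shadow_multipartite ?rl ?andbT ?(ltnW r3) //.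
  exact: cvgs.
have hz : (fun k => density R r (H k)) @ \oo --> (l ^_ r)%:R * b ^+ r.
  rewrite /density; under eq_fun do rewrite vH card_multipartite.
  by apply/(cvg_densityP idoo); apply: cvgs.
split; rewrite ?in01 //; exists H; split=> [k|k|].
- exact: multipartite_uniform.
- by apply: multipartite_free; apply: leq_trans rl; apply: ltnW (ltnW r3).
split=> //; split; last 2 first.
- by apply/cvg_ex; exists ((l ^_ r.-1)%:R * b ^+ r.-1).
- by apply/cvg_ex; exists ((l ^_ r)%:R * b ^+ r).
by under eq_fun do rewrite vH; apply: cvg_id.
Unshelve. all: by end_near. Qed.

Lemma feasible_star (R : realType) (m r : nat) (x : R) :
  (3 <= r)%N -> (3 < m)%N -> x \in `[0, 1] ->
  feasible_region R r (clique_expansion m r) (x, 0).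
Proof.
case: r => [//|[//|s]] _ m3 x01; have /andP[x0 x1] : 0 <= x <= 1 by rewrite in_itv in x01.
have Soo : S @ \oo --> \oo by apply: (cvg_addnl 1).
(* The link is any family of [t n] sets of size [s.+1] on [n] points, so its density tends to
   [x]. *)
pose t (n : nat) := Num.truncn (x * 'C(n, s.+1)%:R).
have tle n : (t n <= 'C(n, s.+1))%N.
  have /andP[tl _] := truncn_itv (mulr_ge0 x0 (ler0n R 'C(n, s.+1))).
  by rewrite -(ler_nat R) (le_trans tl) // ler_piMl.
have starP n : exists H : hypergraph,
    [/\ nvert H = n.+1, uniform s.+2 H, is_free (clique_expansion m s.+2) H,
        #|edges H| = t n & (t n <= #|shadow s.+2 H| <= t n + 'C(n, s))%N].
  pose D := [set A : {set 'I_n} | #|A| == s.+1]%SET.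
  have Dc : size (enum D) = 'C(n, s.+1) by rewrite -cardE card_draws card_ord.
  pose L := [set A in take (t n) (enum D)]%SET.
  have Lt : #|L| = t n.
    rewrite cardsE; have /card_uniqP -> := take_uniq (t n) (enum_uniq D).
    by rewrite size_takel // Dc.
  have Ls : {in L, forall A : {set 'I_n}, #|A| = s.+1}.
    by move=> A; rewrite inE => /mem_take; rewrite mem_enum inE => /eqP.
  exists (star L); split.
  - by rewrite /nvert card_option card_ord.
  - exact: star_uniform.
  - exact: star_free.
  - by rewrite card_star.
  - by rewrite -Lt card_shadow_star_ge // card_shadow_star_le.
have [H hH] := choice starP.
have vH n : nvert (H n) = n.+1 by have [] := hH n.
have fact0 : (s.+1`!)%:R != 0 :> R by rewrite pnatr_eq0 -lt0n fact_gt0.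
have tlim : (fun n => (s.+1`! * t n)%:R / n.+1%:R ^+ s.+1) @ \oo --> x.
  have -> : (fun n => (s.+1`! * t n)%:R / n.+1%:R ^+ s.+1 : R) =
      (fun n => (s.+1`!)%:R * ((t n)%:R / n.+1%:R ^+ s.+1)).
    by apply/funext => n; rewrite natrM mulrA.
  rewrite -(mulVKf fact0 x); apply: cvgMr.
  apply: (cvg_truncn_ratio Soo) => [//|n|]; first exact: mulr_ge0.
  rewrite mulrC -[X in _ --> X]mulr1.
  (* The star has n + 1 vertices but its link only [n]; the identity (n+1)_(s+2) = (n+1) (n)_(s+1)
     reduces the limit to [cvg_ffact_ratio]. *)
  have -> : (fun n => x * 'C(n, s.+1)%:R / n.+1%:R ^+ s.+1) =
      (fun n => x / (s.+1`!)%:R * ((n.+1 ^_ s.+2)%:R / n.+1%:R ^+ s.+2)).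
    apply/funext => n; have n0 : n.+1%:R != 0 :> R by rewrite pnatr_eq0.
    have -> : (n.+1 ^_ s.+2)%:R = n.+1%:R * ('C(n, s.+1)%:R * (s.+1`!)%:R) :> R.
      by rewrite ffactSS natrM -bin_ffact [in LHS]natrM.
    rewrite [n.+1%:R ^+ s.+2]exprS.
    move: (fact0) n0; move: (s.+1`!)%:R ('C(n, s.+1))%:R n.+1%:R => F C N F0 N0.
    by field; rewrite F0 N0 expf_neq0.
  by apply: cvgMr; apply: (cvg_ffact_ratio Soo s.+2).
(* This makes negligible both the shadow sets through [None], at most n^s against order n^(s+1), and
   the edges, at most n^(s+1) against order n^(s+2). *)
have expS_le (n k u : nat) : (u <= n ^ k)%N ->
    (k.+1`! * u)%:R / n.+1%:R ^+ k.+1 <= (k.+1`!)%:R * n.+1%:R^-1 :> R.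
  move=> uk; rewrite exprSr invfM mulrA ler_pM2r ?invr_gt0 //.
  rewrite ler_pdivrMr ?exprn_gt0 // -natrX -natrM ler_nat leq_mul2l.
  by rewrite (leq_trans uk) ?orbT //; case: (k) => // k'; rewrite leq_exp2r.
have hx : (fun n => shadow_density R s.+2 (H n)) @ \oo --> x.
  rewrite /shadow_density; under eq_fun do rewrite vH.
  apply/(cvg_densityP Soo).
  apply: (squeeze_cvgr (f := fun n => (s.+1`! * t n)%:R / n.+1%:R ^+ s.+1)
    (h := fun n => (s.+1`! * t n)%:R / n.+1%:R ^+ s.+1 + (s.+1`!)%:R * n.+1%:R^-1)).
  - near=> n; have [_ _ _ _ /andP[tsh sht]] := hH n.
    rewrite ler_pM2r ?invr_gt0 ?exprn_gt0 ?ltr0n // ler_nat leq_mul2l.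
    rewrite tsh orbT /=.
    apply: le_trans (lerD (lexx _) (expS_le n s _ (bin_leq_exp n s))).
    rewrite -mulrDl ler_pM2r ?invr_gt0 ?exprn_gt0 ?ltr0n // -natrD ler_nat.
    by rewrite -mulnDr leq_mul2l sht orbT.
  - exact: tlim.
  rewrite -[X in _ --> X]addr0; apply: cvgD => //.
  rewrite -[X in _ --> X](mulr0 (s.+1`!)%:R); apply: cvgMr.
  exact: (cvg_inv_order Soo).
have hz : (fun n => density R s.+2 (H n)) @ \oo --> (0 : R).
  rewrite /density; under eq_fun do rewrite vH.
  apply/(cvg_densityP Soo).
  apply: (cvg_sublinear Soo (a := (s.+2`!)%:R)) => n.
  rewrite divr_ge0 ?exprn_ge0 //=; have [_ _ _ -> _] := hH n.
  exact: (expS_le n s.+1 _ (leq_trans (tle n) (bin_leq_exp n s.+1))).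
split=> //=; first by rewrite in_itv /= lexx ler01.
exists H; split=> [n|n|].
- by have [] := hH n.
- by have [] := hH n.
split=> //; split; last 2 first.
- by apply/cvg_ex; exists x.
- by apply/cvg_ex; exists 0.
by under eq_fun do rewrite vH.
Unshelve. all: by end_near. Qed.

Lemma powR_invnK (R : realType) (c : R) (p : nat) :
  (0 < p)%N -> 0 <= c -> (c `^ (p%:R^-1)) ^+ p = c.
Proof.
move=> p0 c0; rewrite -powR_mulrn ?powR_ge0 // -powRrM mulVf ?powRr1 //.
by rewrite pnatr_eq0 -lt0n.
Qed.

(* [l ^_ k] is the falling factorial (l)_k.  The denominator is (l)_(r-1),
   not (l)_r: with (l)_r the formula is off by the factor
   (l - r + 1) ^ (-1/(r-1)) and contradicts, for l > r, the balanced complete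
   l-partite r-graphs, which realize ((l)_(r-1) / l^(r-1), (l)_r / l^r). *)
Theorem theorem1p19 (R : realType) (l r : nat) (hr : (3 <= r)%N)
    (hl : (r <= l)%N) :
  proj_feasible R r (clique_expansion l.+1 r) = `[0, 1]%classic /\
  forall x : R, x \in `[0, (l ^_ r.-1)%:R / l%:R ^+ r.-1] ->
    feasible_max r (clique_expansion l.+1 r) x
      ((l%:R - r%:R + 1) *
         (x ^+ r / (l ^_ r.-1)%:R) `^ ((r%:R - 1)^-1)).
Proof.
have rl : (3 <= r <= l)%N by rewrite hr.
have l3 : (3 < l.+1)%N by rewrite ltnS (leq_trans hr).
split.
  apply/seteqP; split=> [_ [[x z] /= [x01 _ _] <-] //|x /= x01].
  by exists (x, 0) => //; apply: feasible_star.
move=> x; rewrite in_itv /= => /andP[x0 xle].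
case: r hr hl rl xle => [//|p] p2 pl rl; rewrite /= => xle.
have p0 : (0 < p)%N by apply: leq_trans (p2 : (2 <= p)%N).
have l0 : (0 < l)%N by apply: leq_trans pl.
have -> : p.+1%:R - 1 = p%:R :> R by rewrite -natr1 addrK.
have -> : l%:R - p.+1%:R + 1 = (l - p)%:R :> R.
  by rewrite natrB 1?ltnW // -natr1 opprD addrA subrK.
have L0 : 0 < (l ^_ p)%:R :> R by rewrite ltr0n ffact_gt0 ltnW.
(* With p = r - 1, [b] is chosen so that x = (l)_p b^p, the shadow density of the multipartite
   construction. The claimed maximum is then (l - p) x b = (l)_(p+1) b^(p+1), its edge density. *)
set b := (x / (l ^_ p)%:R) `^ p%:R^-1.
have b0 : 0 <= b by apply: powR_ge0.
have bp : b ^+ p = x / (l ^_ p)%:R by rewrite powR_invnK // divr_ge0 // ltW.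
have xE : x = (l ^_ p)%:R * b ^+ p by rewrite bp mulrC divfK // gt_eqF.
have yE : (x ^+ p.+1 / (l ^_ p)%:R) `^ p%:R^-1 = x * b.
  rewrite exprSr -mulrA powRM ?exprn_ge0 ?divr_ge0 ?(ltW L0) // -/b; congr (_ * _).
  by rewrite -powR_mulrn // -powRrM divff ?powRr1 // pnatr_eq0 -lt0n.
rewrite yE; split => /=.
  have -> : (l - p)%:R * (x * b) = (l ^_ p.+1)%:R * b ^+ p.+1.
    by rewrite ffactnSr natrM exprSr [in LHS]xE; ring.
  rewrite {1}xE; apply: feasible_multipartite => //.
  (* After raising to the power [p], b l <= 1 becomes the assumed bound x <= (l)_p / l^p. *)
  rewrite -(@expr_le1 _ p) ?mulr_ge0 // exprMn bp mulrAC.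
  rewrite ler_pdivrMr // mul1r -ler_pdivlMr ?exprn_gt0 ?ltr0n //.
move=> z /= hz; have := feasible_ineq rl hz => /= ineq.
have z0 : 0 <= z by case: hz => _ /=; rewrite in_itv /= => /andP[].
(* The [p]-th powers are compared, multiplied by (l)_p: [ineq] bounds the left one, and (x b)^p
   (l)_p = x^(p+1). *)
rewrite -(@ler_pXn2r _ p) ?nnegrE ?mulr_ge0 //.
rewrite -(ler_pM2r L0) (le_trans ineq) // !exprMn bp exprS.
by rewrite [leRHS](_ : _ = (l - p)%:R ^+ p * (x * x ^+ p)) //; field; rewrite gt_eqF.
Qed.
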